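(* Let $\Gamma$ be a non-elementary hyperbolic group. For every pair of word metrics $d_S,d_{S_\ast}$ on $\Gamma$ associated to finite symmetric sets of generators $S,S_\ast$, the corresponding Manhattan curve satisfies $$\theta_{S_\ast/S}(t)=-\alpha_{\min}t+O(1)\ \text{ as } t\to\infty\qquad\text{and}\qquad \theta_{S_\ast/S}(t)=-\alpha_{\max}t+O(1)\ \text{ as } t\to-\infty .$$ Moreover $\alpha_{\min}$ and $\alpha_{\max}$ are rational.
   Context: For a finite symmetric generating set $S$ of $\Gamma$, $|x|_S$ is the word length of $x$ with respect to $S$, and $d_S(x,y)=|x^{-1}y|_S$. $\Gamma$ is hyperbolic if $(\Gamma,d_S)$ is Gromov hyperbolic for some (equivalently, every) $S$; a hyperbolic group is non-elementary if it is non-amenable (equivalently, neither finite nor virtually $\mathbb{Z}$). The function parametrizing the Manhattan curve for $(d_S,d_{S_\ast})$ is $\theta_{S_\ast/S}(a)=\lim_{n\to\infty}\frac1n\log\sum_{|x|_S=n}e^{-a|x|_{S_\ast}}$, $a\in\mathbb{R}$ (a convex function on $\mathbb{R}$), and $\alpha_{\min}=-\lim_{a\to\infty}\theta_{S_\ast/S}(a)/a$, $\alpha_{\max}=-\lim_{a\to-\infty}\theta_{S_\ast/S}(a)/a$, which are positive and finite. *)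

(* Defs.v *)
From mathcomp Require Import all_boot all_order all_algebra.
From mathcomp Require Import monoid.
From mathcomp Require Import all_classical all_reals all_analysis.

Set Implicit Arguments.
Unset Strict Implicit.
Unset Printing Implicit Defensive.

Import Order.TTheory GRing.Theory Num.Theory.
Import numFieldNormedType.Exports.

Local Open Scope classical_set_scope.
Local Open Scope ring_scope.

(* Lets Landau notations such as f =O_ +oo g elaborate; no such instances are
   declared in the library. *)
Canonical pinfty_nbhs_filter_on (R : realType) : filter_on R :=
  FilterType (pinfty_nbhs R) _.
Canonical ninfty_nbhs_filter_on (R : realType) : filter_on R :=
  FilterType (ninfty_nbhs R) _.

Definition spelled (G : groupType) (S : set G) (n : nat) (x : G) : Prop :=
  exists w : seq G,
    [/\ size w = n, forall s, s \in w -> S s & x = (\prod_(s <- w) s)%g].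

Record symmetric_generating_set (G : groupType) (S : set G) : Prop := {
  sgs_finite : finite_set S ;
  sgs_symmetric : forall s, S s -> S (s^-1)%g ;
  sgs_generating : forall x, exists n, spelled S n x }.

(* Least length of a word in S spelling x; the default value 0 of xget is only
   reached when S does not generate x. *)
Definition word_length (G : groupType) (S : set G) (x : G) : nat :=
  xget 0%N [set n | spelled S n x /\
                    forall m, spelled S m x -> (n <= m)%N].

Definition word_metric (R : realType) (G : groupType) (S : set G) (x y : G) : R :=
  (word_length S (x^-1 * y)%g)%:R.

Definition gromov_product (R : realType) (T : Type) (d : T -> T -> R)
    (x y w : T) : R :=
  (d x w + d y w - d x y) / 2.

Definition gromov_hyperbolic (R : realType) (T : Type) (d : T -> T -> R) : Prop :=
  exists delta : R, forall x y z w : T,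
    Num.min (gromov_product d x y w) (gromov_product d y z w) - delta
      <= gromov_product d x z w.

Definition hyperbolic_group (R : realType) (G : groupType) : Prop :=
  exists S : set G,
    symmetric_generating_set S /\ gromov_hyperbolic (@word_metric R G S).

(* Amenability of a discrete group: a finitely additive, left-invariant
   probability defined on all subsets. *)
Definition amenable (R : realType) (G : groupType) : Prop :=
  exists mu : set G -> R,
    [/\ forall A, 0 <= mu A,
        mu [set: G] = 1,
        forall A B, A `&` B = set0 -> mu (A `|` B) = mu A + mu B &
        forall (g : G) A, mu [set (g * x)%g | x in A] = mu A].

Definition non_elementary_hyperbolic (R : realType) (G : groupType) : Prop :=
  hyperbolic_group R G /\ ~ amenable R G.

Section ManhattanCurve.
Variables (R : realType) (G : groupType) (S Sstar : set G).

Definition sphere (n : nat) : set G := [set x | word_length S x = n].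

Definition manhattan_sum (a : R) (n : nat) : R :=
  \sum_(x \in sphere n) expR (- a * (word_length Sstar x)%:R).

Definition manhattan_curve (a : R) : R :=
  lim ((n%:R^-1 * ln (manhattan_sum a n)) @[n --> \oo]).

Definition alpha_min : R := - lim ((manhattan_curve a / a) @[a --> +oo]).

Definition alpha_max : R := - lim ((manhattan_curve a / a) @[a --> -oo]).

End ManhattanCurve.

(* Main.v *)
Require Import Defs.
From mathcomp Require Import all_boot all_order all_algebra.
From mathcomp Require Import monoid.
From mathcomp Require Import all_classical all_reals all_analysis.
From mathcomp Require Import finmap zify ring lra.

(* Let S0 be a generating set with hyperbolic word metric. By stability of
   quasi-geodesics, a geodesic word for S and a geodesic word for Sstar with the
   same endpoints fellow travel monotonically, so the Sstar-length along an
   S-geodesic word can be computed by minimizing over chains staying in a ball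
   of fixed radius around the word: it is the output of a finite automaton, and
   so is the property of being an S-geodesic word. Deleting and iterating the
   cycles of this automaton shows that, for n = |x|_S, the maximum of |x|_Sstar
   (or of -|x|_Sstar) is rho n + O(1), at least along a subsequence and always
   as an upper bound, where the rational number rho is the largest ratio of a
   cycle. As Sstar-length is additive up to a constant along S-geodesics,
   Fekete's lemma shows that theta exists, and bounding the n-th sum below by
   its largest term and above by this term times the number of terms gives
   t rho <= theta(-t) <= theta(0) + t rho for t >= 0, and similarly for
   theta(t). *)

Import Order.TTheory GRing.Theory Num.Theory.
Import numFieldNormedType.Exports.

Local Open Scope classical_set_scope.
Local Open Scope ring_scope.

Set Implicit Arguments.
Unset Strict Implicit.
Unset Printing Implicit Defensive.

(** * Quasi-geodesics in a hyperbolic metric with integer values *)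

(** This makes [D = O(log D)] explicit: from 4 on, squares lie below powers of two, so [2 ^ k] soon
    exceeds any affine function of [k]. *)
Lemma exp2_le_affine a b k : (2 ^ k <= a * k + b)%N -> (k <= a + b + 3)%N.
Proof.
move=> h; rewrite leqNgt; apply/negP => klarge.
have sq m : (4 <= m -> m * m <= 2 ^ m)%N.
  elim: m => // m IH; rewrite leq_eqVlt => /orP[/eqP <- //|m4].
  by rewrite expnS; have := IH m4; nia.
have := sq k; nia.
Qed.

(** Gromov's inequality for products, with the halving cleared and the subtractions moved across so
    that it can be stated in [nat]. *)
Definition four_point (T : Type) (d : T -> T -> nat) (delta : nat) : Prop :=
  forall x y z w,
  (d x z + d y w <= maxn (d x y + d z w) (d y z + d x w) + delta)%N.

Section HyperbolicGeometry.
Local Open Scope nat_scope.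
Variables (T : Type) (d : T -> T -> nat) (delta : nat).
Hypothesis dxx : forall x, d x x = 0.
Hypothesis dC : forall x y, d x y = d y x.
Hypothesis dtri : forall x y z, d x z <= d x y + d y z.
Hypothesis d4 : four_point d delta.
Hypothesis dgeo : forall x y, exists g : nat -> T,
  [/\ g 0 = x, g (d x y) = y &
      forall s t, s <= t <= d x y -> d (g s) (g t) = t - s].

(** In terms of Gromov products at [z], [(p i | p j)] is at least [D - (lam + k * delta) / 2]. The
    index interval is halved [k] times, and each halving costs one [delta]. *)
Lemma chain_product lam D z (p : nat -> T) k i j :
  i <= j -> j - i <= 2 ^ k ->
  (forall l, i <= l <= j -> D <= d (p l) z) ->
  (forall l, i <= l < j -> d (p l) (p l.+1) <= lam) ->
  2 * D + d (p i) (p j) <= d (p i) z + d (p j) z + lam + k * delta.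
Proof.
elim: k i j => [|k IH] i j ij.
  rewrite expn0 => ij1 far step.
  have := far i; have := far j.
  have [->|ji] : j = i \/ j = i.+1 by lia.
    by rewrite dxx; lia.
  by subst j; have := step i; lia.
rewrite expnS => ijk far step.
pose m := i + (j - i)./2.
have [im mj] : i <= m /\ m <= j by rewrite /m; lia.
have hi := IH i m im _ _ _; have hj := IH m j mj _ _ _.
have {}hi : 2 * D + d (p i) (p m) <= d (p i) z + d (p m) z + lam + k * delta.
  apply: hi => [|l ?|l ?]; [rewrite /m; lia|apply: far; lia|apply: step; lia].
have {}hj : 2 * D + d (p m) (p j) <= d (p m) z + d (p j) z + lam + k * delta.
  apply: hj => [|l ?|l ?]; [rewrite /m; lia|apply: far; lia|apply: step; lia].
by have := d4 (p i) (p m) (p j) z; nia.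
Qed.

Definition quasi_geodesic (lam : nat) (p : nat -> T) (n : nat) : Prop :=
  forall i j, i <= j <= n ->
    d (p i) (p j) <= lam * (j - i) /\ j - i <= lam * d (p i) (p j) + lam.

(* If g t is at the maximal distance D from the path, the points of the geodesic
   at distance 2 D from g t on both sides are joined by a detour along the path
   that has length O(D) and stays D-far from g t, hence D = O(log D). *)
Lemma quasi_geodesic_near lam : exists D, forall p n g,
  quasi_geodesic lam p n ->
  (forall s t, s <= t <= d (p 0) (p n) -> d (g s) (g t) = t - s) ->
  g 0 = p 0 -> g (d (p 0) (p n)) = p n ->
  forall t, t <= d (p 0) (p n) -> exists2 i, i <= n & d (g t) (p i) <= D.
Proof.
pose a := 3 * lam * delta; pose b := 3 * lam * (lam + 3 * delta) + lam + 2.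
exists (lam + (a + b + 6) * delta) => p n g pq gg g0 gm.
set m := d (p 0) (p n) in gg gm *.
(* The least [D] satisfying [P] is the maximal distance from the geodesic to the path. *)
pose P D := [forall t : 'I_m.+1, [exists i : 'I_n.+1, d (g t) (p i) <= D]].
have Pm : P m.
  apply/forallP => t; apply/existsP; exists ord0.
  by rewrite /= -g0 dC gg; have := ltn_ord t; lia.
case: (ex_minnP (ex_intro _ m Pm)) => D PD Dmin.
have near t : t <= m -> exists2 i, i <= n & d (g t) (p i) <= D.
  move=> tm; have /forallP/(_ (inord t))/existsP[i] := PD.
  by rewrite inordK // => h; exists i => //; have := ltn_ord i.
suff Dle : D <= lam + (a + b + 6) * delta.
  by move=> t /near[i ? h]; exists i => //; apply: leq_trans Dle.
case: (posnP D) => [->//|D0].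
have [t tm far] : exists2 t, t <= m & forall i, i <= n -> D <= d (g t) (p i).
  have : ~~ P D.-1 by apply/negP => /Dmin; lia.
  move/forallPn => -[t /existsPn h]; exists t; first by have := ltn_ord t.
  move=> i iN; have := h (inord i); rewrite inordK //; lia.
(* The last inequality says that the Gromov product of [g (t - 2 * D)] and [p i] at [g t] is at
   least [D]. If [t < 2 * D], truncated subtraction yields the endpoint [p 0], already on the
   path. *)
have [i [iN id iP]] : exists i, [/\ i <= n, d (g (t - 2 * D)) (p i) <= D &
    2 * D + d (g (t - 2 * D)) (p i) <= d (g (t - 2 * D)) (g t) + d (p i) (g t)].
  case: (leqP (2 * D) t) => tD.
    have [i iN id] := near (t - 2 * D) ltac:(lia).
    exists i; split=> //; rewrite gg; last by lia.
    by have := far i iN; rewrite dC; lia.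
  exists 0; have -> : t - 2 * D = 0 by lia.
  by rewrite g0 dxx; split=> //; have := far 0; rewrite dC; lia.
have [j [jN jd jP]] : exists j, [/\ j <= n, d (g (minn m (t + 2 * D))) (p j) <= D &
    2 * D + d (g (minn m (t + 2 * D))) (p j)
      <= d (g (minn m (t + 2 * D))) (g t) + d (p j) (g t)].
  case: (leqP (t + 2 * D) m) => tD.
    have [j jN jd] := near (t + 2 * D) tD.
    exists j; split=> //; rewrite [d (g (_ + _)) (g t)]dC gg; last by lia.
    by have := far j jN; rewrite dC; lia.
  by exists n; rewrite gm dxx; split=> //; have := far n; rewrite dC; lia.
set u := g _ in id iP; set v := g _ in jd jP.
have uvz : d u v = d u (g t) + d v (g t).
  by rewrite [d v _]dC !gg; lia.
have uv : d u v <= 4 * D by rewrite gg; lia.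
(* [2 ^ k] has to bound the number of path steps between [i] and [j]; minimality of [k] keeps
   [2 ^ k.-1] below an affine function of [D]. *)
pose k := up_log 2 (lam * (6 * D) + lam + 2).
have /andP[kl kr] : 2 ^ k.-1 < lam * (6 * D) + lam + 2 <= 2 ^ k.
  by apply: up_log_bounds => //; lia.
have ij : d (p i) (p j) <= 6 * D.
  have := dtri (p i) u (p j); have := dtri u v (p j); rewrite [d (p i) u]dC; lia.
have ijP : 2 * D + d (p i) (p j) <= d (p i) (g t) + d (p j) (g t) + lam + k * delta.
  have step l : l < n -> d (p l) (p l.+1) <= lam.
    by move=> ln; have := pq l l.+1 ltac:(lia); nia.
  have far' l : l <= n -> D <= d (p l) (g t) by move/far; rewrite dC.
  case: (leqP i j) => le_ij.
    have ijk : j - i <= 2 ^ k by have := pq i j ltac:(lia); nia.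
    by apply: chain_product => // l ?; [apply: far'; lia|apply: step; lia].
  have ijk : i - j <= 2 ^ k.
    by have := pq j i ltac:(lia); rewrite [d (p j) _]dC; nia.
  rewrite [d (p i) (p j)]dC [d (p i) _ + _]addnC.
  by apply: chain_product => // [|l ?|l ?]; [lia|apply: far'; lia|apply: step; lia].
(* The products of [u, p i], of [p i, p j] and of [p j, v] at [g t] are all large, while that of
   [u, v] is 0 because [g t] lies between them; two uses of the four-point inequality link them. *)
have D2 : 2 * D <= lam + (k + 2) * delta.
  have := d4 u (p i) (p j) (g t); have := d4 u (p j) v (g t).
  rewrite [d (p j) v]dC mulnDl => h1 h2; lia.
have D2' : 2 * D <= lam + (k.-1 + 3) * delta.
  by apply: leq_trans D2 _; rewrite leq_add2l leq_mul2r; lia.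
have k_le : k.-1 <= a + b + 3.
  apply: exp2_le_affine; apply: leq_trans (ltnW kl) _.
  have := leq_mul (leqnn (3 * lam)) D2'.
  rewrite /a /b !mulnDr !mulnDl !mulnDr !mulnA; lia.
have : (k.-1 + 3) * delta <= (a + b + 6) * delta by rewrite leq_mul2r; lia.
lia.
Qed.

(* Points of the geodesic close to the path before time i, and those close to
   it after time i, cover the geodesic, so two adjacent points are of
   different kinds. *)
Lemma geodesic_near lam : exists D, forall p n g,
  quasi_geodesic lam p n ->
  (forall s t, s <= t <= d (p 0) (p n) -> d (g s) (g t) = t - s) ->
  g 0 = p 0 -> g (d (p 0) (p n)) = p n ->
  forall i, i <= n -> exists2 t, t <= d (p 0) (p n) & d (p i) (g t) <= D.
Proof.
have [D near] := quasi_geodesic_near lam.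
exists (lam * (lam * (2 * D + 1) + lam) + D) => p n g pq gg g0 gm i iN.
set m := d (p 0) (p n) in gg gm *.
pose P t := [exists j : 'I_i.+1, d (g t) (p j) <= D].
(* Points of the path that are close in space are close in time, so [p i] cannot stray far from
   [p j] in between. *)
have close j k : j <= i <= k -> k <= n -> d (p j) (p k) <= 2 * D + 1 ->
    d (p j) (p i) <= lam * (lam * (2 * D + 1) + lam).
  move=> /andP[ji ik] kn jk; have [h _] := pq j i ltac:(lia).
  have [_ h'] := pq j k ltac:(lia).
  apply: leq_trans h _; rewrite leq_mul2l; apply/orP; right.
  have : lam * d (p j) (p k) <= lam * (2 * D + 1) by rewrite leq_mul2l jk orbT.
  lia.
case: (boolP (P m)) => [/existsP[j]|nPm].
  rewrite gm => jd; exists m => //; rewrite gm.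
  have := close j n ltac:(have := ltn_ord j; lia) (leqnn n).
  rewrite dC in jd => /(_ ltac:(lia)) h.
  by have := dtri (p i) (p j) (p n); rewrite [d (p i) (p j)]dC; lia.
have P0 : P 0 by apply/existsP; exists ord0; rewrite g0 dxx.
have [t tm /andP[Pt nPt]] : exists2 t, t < m & P t && ~~ P t.+1.
  elim: m nPm {gg gm near} => [|m IH]; first by rewrite P0.
  case: (boolP (P m)) => [Pm nPm|nPm _]; first by exists m; rewrite ?Pm.
  by have [t tm h] := IH nPm; exists t => //; apply: ltnW.
have [j jd] := existsP Pt.
have [k kn kd] := near p n g pq gg g0 gm t.+1 tm.
have ik : i < k.
  rewrite ltnNge; apply/negP => ki; move/existsPn: nPt => /(_ (inord k)).
  by rewrite inordK ?kd.
have tt : d (g t) (g t.+1) = 1 by rewrite gg; lia.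
have jk : d (p j) (p k) <= 2 * D + 1.
  have := dtri (p j) (g t) (p k); have := dtri (g t) (g t.+1) (p k).
  by rewrite [d (p j) (g t)]dC; lia.
exists t; first exact: ltnW.
have := close j k ltac:(have := ltn_ord j; lia) kn jk.
have := dtri (p i) (p j) (g t); rewrite [d (p i) (p j)]dC [d (p j) (g t)]dC; lia.
Qed.

(** Both paths are compared with one geodesic joining their common endpoints. *)
Lemma quasi_geodesic_fellow_travel lam : exists D, forall p q n m,
  quasi_geodesic lam p n -> quasi_geodesic lam q m ->
  p 0 = q 0 -> p n = q m ->
  forall i, i <= n -> exists2 j, j <= m & d (p i) (q j) <= D.
Proof.
have [D1 near1] := geodesic_near lam.
have [D2 near2] := quasi_geodesic_near lam.
exists (D1 + D2) => p q n m pq qq e0 e1 i iN.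
have [g [g0 g1 gg]] := dgeo (p 0) (p n).
have [t tm td] := near1 p n g pq gg g0 g1 i iN.
move: tm g1 gg; rewrite e0 e1 => tm g1 gg.
have [j jm jd] := near2 q m g qq gg (etrans g0 e0) g1 t tm.
by exists j => //; have := dtri (p i) (g t) (q j); lia.
Qed.

Lemma quasi_geodesicW lam p n m :
  m <= n -> quasi_geodesic lam p n -> quasi_geodesic lam p m.
Proof. by move=> mn pq i j ?; apply: pq; lia. Qed.

(** [p i] is close to a point of the geodesic, along which distances add exactly. *)
Lemma quasi_geodesic_additive lam : exists D, forall p n,
  quasi_geodesic lam p n -> forall i, i <= n ->
  d (p 0) (p i) + d (p i) (p n) <= d (p 0) (p n) + D.
Proof.
have [D near] := geodesic_near lam.
exists (2 * D) => p n pq i iN.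
have [g [g0 g1 gg]] := dgeo (p 0) (p n).
have [t tm td] := near p n g pq gg g0 g1 i iN.
have h0 := gg 0 t ltac:(lia).
have h1 : d (g t) (g (d (p 0) (p n))) = d (p 0) (p n) - t.
  by apply: gg; rewrite tm leqnn.
rewrite g0 in h0; rewrite g1 in h1.
have := dtri (p 0) (g t) (p i); have := dtri (p i) (g t) (p n).
by rewrite [d (g t) (p i)]dC; lia.
Qed.

(* A monotone rematching stays close: for i' <= i and j <= j' with p i' near
   q j' and p i near q j, quasi-additivity of both paths bounds d (p i) (q j'). *)
Lemma monotone_fellow_travel lam K : exists D, forall p q n m,
  quasi_geodesic lam p n -> quasi_geodesic lam q m -> p 0 = q 0 ->
  forall i' i j j', i' <= i <= n -> j <= j' <= m ->
  d (p i') (q j') <= K -> d (p i) (q j) <= K -> d (p i) (q j') <= D.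
Proof.
have [C add] := quasi_geodesic_additive lam.
exists (2 * C + 3 * K) => p q n m pq qq e0 i' i j j' /andP[ii iN] /andP[jj jm] h1 h2.
have a1 := add p i (quasi_geodesicW iN pq) i' ii.
have a2 := add q j' (quasi_geodesicW jm qq) j jj.
rewrite e0 in a1.
have := dtri (q 0) (q j) (p i); have := dtri (q 0) (p i') (q j').
have := dtri (p i) (p i') (q j').
by rewrite [d (q j) (p i)]dC [d (p i) (p i')]dC; lia.
Qed.
End HyperbolicGeometry.

(** * Word metrics *)

Definition word_prod (G : groupType) (w : seq G) : G := (\prod_(s <- w) s)%g.

Lemma word_prod_cat (G : groupType) (w v : seq G) :
  word_prod (w ++ v) = (word_prod w * word_prod v)%g.
Proof. exact: big_cat. Qed.

Lemma word_prod1 (G : groupType) (s : G) : word_prod [:: s] = s.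
Proof. exact: big_seq1. Qed.

Lemma word_prod_nil (G : groupType) : word_prod [::] = 1%g :> G.
Proof. exact: big_nil. Qed.

Definition word_over (G : groupType) (S : set G) (w : seq G) : Prop :=
  forall s, s \in w -> S s.

Lemma word_over_cat (G : groupType) (S : set G) (w v : seq G) :
  word_over S (w ++ v) <-> word_over S w /\ word_over S v.
Proof.
split=> [h|[hw hv] s]; last by rewrite mem_cat => /orP[/hw|/hv].
by split=> s sw; apply: h; rewrite mem_cat sw ?orbT.
Qed.

Definition word_dist (G : groupType) (S : set G) (x y : G) : nat :=
  word_length S (x^-1 * y)%g.

Section WordLength.
Variables (G : groupType) (S : set G).
Hypothesis hS : symmetric_generating_set S.
Local Notation wl := (word_length S).
Local Notation wd := (word_dist S).

Lemma word_length_spec x :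
  spelled S (wl x) x /\ forall m, spelled S m x -> (wl x <= m)%N.
Proof.
apply: (@xgetPex _ 0%N [set n | spelled S n x /\
  forall m, spelled S m x -> (n <= m)%N]).
have ex : exists n, `[< spelled S n x >].
  by have [n xn] := sgs_generating hS x; exists n; apply/asboolP.
case: (ex_minnP ex) => n /asboolP xn nmin.
by exists n; split=> // m /asboolP; apply: nmin.
Qed.

Lemma word_length_le w : word_over S w -> (wl (word_prod w) <= size w)%N.
Proof.
by move=> wS; have [_] := word_length_spec (word_prod w); apply; exists w.
Qed.

Lemma geodesic_word_ex x :
  exists w, [/\ word_over S w, size w = wl x & word_prod w = x].
Proof. by have [[w [sw wS xw]] _] := word_length_spec x; exists w. Qed.

Lemma word_length1 : wl 1%g = 0%N.
Proof.
apply/eqP; rewrite -leqn0 -(word_prod_nil G).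
by apply: (@word_length_le [::]) => s; rewrite in_nil.
Qed.

Lemma word_lengthM x y : (wl (x * y)%g <= wl x + wl y)%N.
Proof.
have [w [wS <- <-]] := geodesic_word_ex x.
have [v [vS <- <-]] := geodesic_word_ex y.
rewrite -word_prod_cat -size_cat; apply: word_length_le.
by apply/word_over_cat.
Qed.

Lemma word_lengthV x : wl (x^-1)%g = wl x.
Proof.
have le y : (wl (y^-1)%g <= wl y)%N.
  have [w [wS <- <-]] := geodesic_word_ex y.
  have -> : ((word_prod w)^-1 = word_prod (rev [seq s^-1 | s <- w]))%g.
    elim: (w) => [|s u IH]; first by rewrite !word_prod_nil invg1.
    rewrite map_cons rev_cons -cats1 word_prod_cat word_prod1 -IH -invgM.
    by rewrite -cat1s word_prod_cat word_prod1.
  rewrite -[size w](size_map (fun s => s^-1)%g) -size_rev.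
  apply: word_length_le => s; rewrite mem_rev => /mapP[t tw ->].
  exact/(sgs_symmetric hS)/wS.
by apply/eqP; rewrite eqn_leq le /=; rewrite -{1}[x]invgK le.
Qed.

Lemma word_dist_refl x : wd x x = 0%N.
Proof. by rewrite /word_dist mulVg word_length1. Qed.

Lemma word_distC x y : wd x y = wd y x.
Proof. by rewrite /word_dist -word_lengthV invgM invgK. Qed.

Lemma word_dist_tri x y z : (wd x z <= wd x y + wd y z)%N.
Proof.
rewrite /word_dist; have -> : (x^-1 * z = (x^-1 * y) * (y^-1 * z))%g.
  by rewrite mulgA mulgK.
exact: word_lengthM.
Qed.

Lemma word_dist1 x : wd 1%g x = wl x.
Proof. by rewrite /word_dist invg1 mul1g. Qed.

Lemma word_distMl z x y : wd (z * x)%g (z * y)%g = wd x y.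
Proof. by rewrite /word_dist invgM -!mulgA mulKg. Qed.

Lemma word_dist_prefix w i j : word_over S w -> (i <= j)%N ->
  (wd (word_prod (take i w)) (word_prod (take j w)) <= j - i)%N.
Proof.
move=> wS ij.
have -> : take j w = take i w ++ take (j - i) (drop i w).
  by rewrite -takeD subnKC.
rewrite word_prod_cat /word_dist mulKg.
apply: leq_trans (word_length_le _) _; last by rewrite size_take; case: ifP => //; lia.
by move=> s /mem_take /mem_drop; apply: wS.
Qed.

Lemma finite_ball n : finite_set [set x | (wl x <= n)%N].
Proof.
have fs k : finite_set [set x | spelled S k x].
  elim: k => [|k IH].
    apply: (@sub_finite_set _ _ [set 1%g]); last exact: finite_set1.
    by move=> x [w [/size0nil -> _ ->]]; rewrite big_nil.
  have := finite_image2 (fun s y : G => s * y)%g (sgs_finite hS) IH.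
  apply: sub_finite_set => x [[|s w] [//= [sw] wS ->]]; exists s.
    by apply: wS; rewrite mem_head.
  exists (word_prod w); last by rewrite big_cons.
  by exists w; split=> // t tw; apply: wS; rewrite in_cons tw orbT.
apply: (@sub_finite_set _ _ (\bigcup_(k in `I_n.+1) [set x | spelled S k x])).
  move=> x /= xn; exists (wl x) => //=.
  by have [] := word_length_spec x.
by apply: bigcup_finite => //; apply: finite_II.
Qed.

Lemma ball_enum n : exists B : seq G, forall x, (x \in B) = (wl x <= n)%N.
Proof.
have /finite_seqP[B BE] := finite_ball n; exists B => x.
by apply/idP/idP => [xB|xn]; [have : [set` B] x by []|]; rewrite -?BE //=;
  have : [set x | (wl x <= n)%N] x by []; rewrite BE.
Qed.

End WordLength.

Lemma word_length_compare (G : groupType) (S X : set G) :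
  symmetric_generating_set S -> symmetric_generating_set X ->
  exists L, forall x, (word_length X x <= L * word_length S x)%N.
Proof.
move=> hS hX; have /finite_seqP[E SE] := sgs_finite hS.
exists (\max_(s <- E) word_length X s) => x.
have [w [wS <- <-]] := geodesic_word_ex hS x.
elim: w wS => [|s w IH] wS; first by rewrite word_prod_nil (word_length1 hX).
have /word_over_cat[ws ww] : word_over S ([:: s] ++ w) by [].
rewrite -cat1s word_prod_cat word_prod1 size_cat mulnDr /= muln1.
apply: leq_trans (word_lengthM hX _ _) (leq_add _ (IH ww)).
have sE : s \in E by have := ws s (mem_head _ _); rewrite SE.
by rewrite (big_rem s) //= leq_maxl.
Qed.

Lemma gromov_hyperbolic_four_point (R : realType) (G : groupType) (S : set G) :
  symmetric_generating_set S ->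
  gromov_hyperbolic (@word_metric R G S) -> exists delta, four_point (word_dist S) delta.
Proof.
(* The factor 2 comes from clearing the halves in the Gromov products. *)
move=> hS [delta hyp]; have [D hD] : exists D : nat, 2 * delta <= D%:R.
  exists (Num.bound `|2 * delta|); apply: le_trans (ltW (archi_boundP (normr_ge0 _))).
  exact: ler_norm.
exists D => x y z w; rewrite -(ler_nat R) !natrD.
have := hyp x y z w; rewrite /gromov_product /word_metric -!/(word_dist _ _ _).
have := leq_maxl (word_dist S x y + word_dist S z w) (word_dist S y z + word_dist S x w).
have := leq_maxr (word_dist S x y + word_dist S z w) (word_dist S y z + word_dist S x w).
move: (maxn _ _) => M; rewrite -!(ler_nat R) !natrD => h1 h2.
by rewrite lerBlDr ge_min => /orP[]; lra.
Qed.

Definition path_of_word (G : groupType) (w : seq G) (i : nat) : G :=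
  word_prod (take i w).

(** Replacing the letters between [i] and [j] by a shortest word shows that the excess of length
    over distance for a subword is at most that of the whole word. *)
Lemma word_length_through (G : groupType) (S : set G) w i j :
  symmetric_generating_set S -> word_over S w -> (i <= j)%N -> (j <= size w)%N ->
  (word_length S (word_prod w) + j <= size w + i +
     word_dist S (word_prod (take i w)) (word_prod (take j w)))%N.
Proof.
move=> hS wS ij jw.
have h1 := word_dist_prefix hS wS (leq0n i); rewrite take0 word_prod_nil in h1.
have h2 := word_dist_prefix hS wS jw; rewrite take_size in h2.
have := word_dist_tri hS 1%g (word_prod (take i w)) (word_prod w).
have := word_dist_tri hS (word_prod (take i w)) (word_prod (take j w)) (word_prod w).
rewrite word_dist1 //; lia.
Qed.

Lemma word_dist_geodesic (G : groupType) (S : set G) (x y : G) :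
  symmetric_generating_set S -> exists g : nat -> G,
  [/\ g 0%N = x, g (word_dist S x y) = y &
      forall s t, (s <= t <= word_dist S x y)%N -> word_dist S (g s) (g t) = (t - s)%N].
Proof.
move=> hS; have [w [wS sw pw]] := geodesic_word_ex hS (x^-1 * y)%g.
exists (fun t => x * path_of_word w t)%g; split.
- by rewrite /path_of_word take0 word_prod_nil mulg1.
- by rewrite /path_of_word take_oversize ?sw // pw mulVKg.
have -> : word_dist S x y = size w by rewrite sw.
move=> s t /andP[st tw].
rewrite word_distMl //; apply/eqP; rewrite eqn_leq word_dist_prefix //=.
have := word_length_through hS wS st tw.
rewrite pw -sw /path_of_word; lia.
Qed.

Definition geodesic_word (G : groupType) (S : set G) (w : seq G) : Prop :=
  word_over S w /\ word_length S (word_prod w) = size w.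

(* The additive error 2 is the loss caused by appending one letter to a geodesic
   word. *)
Definition almost_geodesic_word (G : groupType) (S : set G) (w : seq G) : Prop :=
  word_over S w /\ (size w <= word_length S (word_prod w) + 2)%N.

Lemma geodesic_word_almost (G : groupType) (S : set G) w :
  geodesic_word S w -> almost_geodesic_word S w.
Proof. by move=> [wS h]; split=> //; rewrite h; lia. Qed.

Lemma geodesic_word_catl (G : groupType) (S : set G) w v :
  symmetric_generating_set S -> geodesic_word S (w ++ v) -> geodesic_word S w.
Proof.
move=> hS [/word_over_cat[wS vS]]; rewrite word_prod_cat size_cat => h.
split=> //; have := word_lengthM hS (word_prod w) (word_prod v).
by have := word_length_le hS wS; have := word_length_le hS vS; lia.
Qed.

Lemma almost_geodesic_rcons (G : groupType) (S : set G) w s :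
  symmetric_generating_set S -> geodesic_word S w -> S s ->
  almost_geodesic_word S (rcons w s).
Proof.
move=> hS [wS h] Ss; have sS : word_over S [:: s] by move=> t; rewrite inE => /eqP ->.
split; first by rewrite -cats1; apply/word_over_cat.
rewrite size_rcons -cats1 word_prod_cat -h.
have := word_lengthM hS (word_prod w * word_prod [:: s])%g (word_prod [:: s])^-1%g.
rewrite mulgK word_lengthV // => h1; apply: leq_ltn_trans h1 _.
by rewrite ltn_add2l ltnS; exact: (word_length_le hS sS).
Qed.

Lemma geodesic_word_of (G : groupType) (S : set G) (x : G) :
  symmetric_generating_set S ->
  exists w, [/\ geodesic_word S w, word_prod w = x & size w = word_length S x].
Proof.
move=> hS; have [w [wS sw pw]] := geodesic_word_ex hS x.
by exists w; split=> //; split=> //; rewrite pw sw.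
Qed.

Lemma quasi_geodesic_le (T : Type) (d : T -> T -> nat) lam lam' p n :
  (lam <= lam')%N -> quasi_geodesic d lam p n -> quasi_geodesic d lam' p n.
Proof.
move=> le h i j /h[h1 h2]; split; first by apply: leq_trans h1 _; rewrite leq_mul2r le orbT.
by apply: leq_trans h2 (leq_add _ le); rewrite leq_mul2r le orbT.
Qed.

Lemma almost_geodesic_quasi_geodesic (G : groupType) (S0 S : set G) :
  symmetric_generating_set S0 -> symmetric_generating_set S ->
  exists lam, forall w, almost_geodesic_word S w ->
    quasi_geodesic (word_dist S0) lam (path_of_word w) (size w).
Proof.
move=> h0 hS; have [L hL] := word_length_compare hS h0.
have [L' hL'] := word_length_compare h0 hS.
(* [L] and [L'] compare the two metrics, and 2 absorbs the excess of an almost geodesic word. *)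
exists (L + L' + 2)%N => w [wS sw] i j /andP[ij jw].
have h2 := word_dist_prefix hS wS ij.
have h3 := word_length_through hS wS ij jw.
have := hL ((path_of_word w i)^-1 * path_of_word w j)%g.
have := hL' ((path_of_word w i)^-1 * path_of_word w j)%g.
by rewrite -!/(word_dist _ _ _) /path_of_word; nia.
Qed.

(** * Fellow travelling of geodesic words over two generating sets *)

Section FellowTravel.
Variables (G : groupType) (S0 S X : set G) (delta : nat).
Hypotheses (h0 : symmetric_generating_set S0) (hS : symmetric_generating_set S).
Hypothesis (hX : symmetric_generating_set X).
Hypothesis d4 : four_point (word_dist S0) delta.

Let wd0C := word_distC h0.
Let wd0xx := word_dist_refl h0.
Let wd0tri := word_dist_tri h0.
Let wd0geo x y := word_dist_geodesic x y h0.

(** Words over both sets are quasi-geodesics for the hyperbolic metric of [S0]. [K] is the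
    fellow-travelling distance; the larger radius [K'] allows matched indices to be replaced by
    their running maximum. *)
Lemma monotone_matching : exists K K', forall w v,
  almost_geodesic_word S w -> geodesic_word X v -> word_prod w = word_prod v ->
  (forall i, (i <= size w)%N -> exists2 j, (j <= size v)%N &
     (word_dist S0 (path_of_word w i) (path_of_word v j) <= K)%N) /\
  (forall i' i j j', (i' <= i <= size w)%N -> (j <= j' <= size v)%N ->
     (word_dist S0 (path_of_word w i') (path_of_word v j') <= K)%N ->
     (word_dist S0 (path_of_word w i) (path_of_word v j) <= K)%N ->
     (word_dist S0 (path_of_word w i) (path_of_word v j') <= K')%N).
Proof.
have [l1 q1] := almost_geodesic_quasi_geodesic h0 hS.
have [l2 q2] := almost_geodesic_quasi_geodesic h0 hX.
have [K hK] := quasi_geodesic_fellow_travel wd0xx wd0C wd0tri d4 wd0geo (maxn l1 l2).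
have [K' hK'] := monotone_fellow_travel wd0xx wd0C wd0tri d4 wd0geo (maxn l1 l2) K.
exists K, K' => w v hw /geodesic_word_almost hv wv.
have qw := quasi_geodesic_le (leq_maxl l1 l2) (q1 w hw).
have qv := quasi_geodesic_le (leq_maxr l1 l2) (q2 v hv).
have e0 : path_of_word w 0 = path_of_word v 0 by rewrite /path_of_word !take0.
split; last by move=> i' i j j'; exact: (hK' _ _ _ _ qw qv e0).
by apply: hK => //; rewrite /path_of_word !take_size.
Qed.

(** Geodesic words for [x] and [y] concatenate to a geodesic word over [S], so a geodesic word over
    [X] for [x * y] passes near [x]. *)
Lemma word_length_quasi_additive : exists C, forall x y,
  word_length S (x * y)%g = (word_length S x + word_length S y)%N ->
  (word_length X x + word_length X y <= word_length X (x * y)%g + C)%N.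
Proof.
have [K [K1 hK]] := monotone_matching.
have [L hL] := word_length_compare h0 hX.
exists (2 * (L * K))%N => x y xy.
have [wx [[wxS _] px sx]] := geodesic_word_of x hS.
have [wy [[wyS _] py sy]] := geodesic_word_of y hS.
have [v [[vX _] pv sv]] := geodesic_word_of (x * y)%g hX.
have gw : geodesic_word S (wx ++ wy).
  by split; [apply/word_over_cat|rewrite word_prod_cat px py size_cat sx sy].
have gv : geodesic_word X v by split=> //; rewrite pv sv.
have wv : word_prod (wx ++ wy) = word_prod v by rewrite word_prod_cat px py pv.
have [near _] := hK _ _ (geodesic_word_almost gw) gv wv.
have [j jv] := near (size wx) ltac:(rewrite size_cat; exact: leq_addr).
rewrite /path_of_word take_size_cat // px => xj.
have xj' : (word_dist X x (word_prod (take j v)) <= L * K)%N.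
  by apply: leq_trans (hL _) _; rewrite leq_mul2l xj orbT.
have h1 := word_dist_prefix hX vX (leq0n j).
have h2 := word_dist_prefix hX vX jv.
have := word_dist_tri hX 1%g (word_prod (take j v)) x.
have := word_dist_tri hX x (word_prod (take j v)) (x * y)%g.
rewrite take0 word_prod_nil word_dist1 // in h1; rewrite take_size pv in h2.
rewrite !word_dist1 //.
rewrite [word_dist X (word_prod _) x]word_distC // {1}/word_dist mulKg -sv; lia.
Qed.
End FellowTravel.

(** * The automaton computing word lengths along geodesics *)

Lemma bigmin_leq_mem (T : eqType) (B : seq T) (x : nat) (F : T -> nat) h :
  h \in B -> (\big[minn/x]_(k <- B) F k <= F h)%N.
Proof.
elim: B => // k B IH; rewrite inE big_cons => /orP[/eqP ->|/IH]; first exact: geq_minl.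
by move=> hB; rewrite geq_min hB orbT.
Qed.

Lemma bigmin_shift (T : eqType) (B : seq T) (x x' c c' : nat) (F F' : T -> nat) :
  (x + c = x' + c')%N -> (forall h, h \in B -> F h + c = F' h + c')%N ->
  (\big[minn/x]_(k <- B) F k + c = \big[minn/x']_(k <- B) F' k + c')%N.
Proof.
move=> xc; elim: B => [|k B IH] FB; first by rewrite !big_nil.
rewrite !big_cons !addn_minl IH => [|h hB]; last by apply: FB; rewrite inE hB orbT.
by rewrite FB ?mem_head.
Qed.

Lemma bigmin_lipschitz (T : Type) (B : seq T) (x x' c : nat) (F F' : T -> nat) :
  (x <= x' + c)%N -> (forall h, F h <= F' h + c)%N ->
  (\big[minn/x]_(k <- B) F k <= \big[minn/x']_(k <- B) F' k + c)%N.
Proof.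
move=> xc FF; elim: B => [|k B IH]; first by rewrite !big_nil.
by rewrite !big_cons addn_minl leq_min !geq_min FF IH orbT.
Qed.

Section BandCost.
Variables (G : groupType) (X : set G) (B : seq G).
Hypothesis hX : symmetric_generating_set X.
Hypothesis B1 : 1%g \in B.
Local Notation wl := (word_length X).

(* band_cost (s_1 ... s_n) h is the least X-length of a chain from 1 through
   y_0, ..., y_(n-1) to y_n = s_1 ... s_n h, where y_i is in s_1 ... s_i B for
   i < n. Its update depends only on its values on B and commutes with adding
   constants. *)
Definition band_step (f : G -> nat) (s h : G) : nat :=
  \big[minn/(f 1%g + wl (s * h)%g)%N]_(k <- B) (f k + wl (k^-1 * (s * h))%g)%N.

Definition band_cost (w : seq G) : G -> nat := foldl band_step wl w.

Lemma band_cost_rcons w s h :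
  band_cost (rcons w s) h = band_step (band_cost w) s h.
Proof. by rewrite /band_cost foldl_rcons. Qed.

Lemma band_step_le f s h k :
  k \in B -> (band_step f s h <= f k + wl (k^-1 * (s * h))%g)%N.
Proof. exact: (bigmin_leq_mem _ (fun k => f k + wl (k^-1 * (s * h))%g)%N). Qed.

Lemma band_cost_ge w h : (wl (word_prod w * h)%g <= band_cost w h)%N.
Proof.
elim/last_ind: w h => [|w s IH] h; first by rewrite word_prod_nil mul1g.
rewrite band_cost_rcons -cats1 word_prod_cat word_prod1.
have le k : (wl (word_prod w * s * h)%g <= band_cost w k + wl (k^-1 * (s * h))%g)%N.
  have -> : (word_prod w * s * h = word_prod w * k * (k^-1 * (s * h)))%g.
    by rewrite -!mulgA mulVKg.
  by apply: leq_trans (word_lengthM hX _ _) _; rewrite leq_add2r.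
apply: (big_ind (fun n => wl _ <= n)%N) => // [|m n hm hn]; last by rewrite leq_min hm.
by have := le 1%g; rewrite invg1 mul1g.
Qed.

(** Only the last jump of a chain depends on its endpoint. *)
Lemma band_cost_lipschitz w h k : (band_cost w h <= band_cost w k + wl (k^-1 * h)%g)%N.
Proof.
have tri x : (wl (x * h)%g <= wl (x * k)%g + wl (k^-1 * h)%g)%N.
  by have := word_lengthM hX (x * k)%g (k^-1 * h)%g; rewrite -mulgA mulVKg.
case/lastP: w => [|w s]; first by have := tri 1%g; rewrite !mul1g.
rewrite !band_cost_rcons; apply: bigmin_lipschitz => [|l].
  by rewrite -addnA leq_add2l tri.
by rewrite -addnA leq_add2l !mulgA tri.
Qed.

(** The constants [c] and [c'] on the two sides encode a difference of either sign within [nat]. *)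
Lemma band_cost_shift w w' c c' v h :
  (forall k, k \in B -> band_cost w k + c = band_cost w' k + c')%N -> h \in B ->
  (band_cost (w ++ v) h + c = band_cost (w' ++ v) h + c')%N.
Proof.
move=> ww hB; elim/last_ind: v h hB => [|v s IH] h hB; first by rewrite !cats0 ww.
rewrite -!rcons_cat !band_cost_rcons; apply: bigmin_shift => [|k kB].
  by rewrite addnAC IH // addnAC.
by rewrite addnAC IH // addnAC.
Qed.

(** The state is the cost function on [B], normalized by its value at 1; the Lipschitz bound leaves
    finitely many such functions. *)
Lemma finite_band_state : exists (Q : finType) (st : seq G -> Q), forall w w',
  st w = st w' -> forall k, k \in B ->
  (band_cost w k + band_cost w' 1%g = band_cost w' k + band_cost w 1%g)%N.
Proof.
pose c := \max_(k <- B) wl k.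
have wlB k : k \in B -> (wl k <= c)%N by move=> kB; rewrite /c (big_rem k) //= leq_maxl.
exists {ffun 'I_(size B) -> 'I_(2 * c).+1}%N.
(* Adding [c] first makes the truncated subtraction exact, with values between 0 and [2 * c]. *)
exists (fun w => [ffun i : 'I_(size B) =>
  inord (band_cost w (nth 1%g B i) + c - band_cost w 1%g)%N]).
move=> w w' eqst k kB; have /ffunP/(_ (Ordinal (etrans (index_mem k B) kB))) := eqst.
rewrite !ffunE nth_index // => /(congr1 val) /=.
have bd u : (band_cost u k <= band_cost u 1%g + c)%N /\
            (band_cost u 1%g <= band_cost u k + c)%N.
  have := band_cost_lipschitz u k 1%g; have := band_cost_lipschitz u 1%g k.
  by rewrite mulg1 invg1 mul1g word_lengthV //; have := wlB k kB; lia.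
have [? ?] := bd w; have [? ?] := bd w'.
by rewrite !inordK; lia.
Qed.

End BandCost.

(** * Finitely many states of geodesic words *)

Section FiniteStates.
Variables (G : groupType) (S0 : set G) (delta : nat).
Hypotheses (h0 : symmetric_generating_set S0) (d4 : four_point (word_dist S0) delta).

(** A geodesic word [v] over [X] with the same product is cut at points matched with the prefixes of
    [w]; the resulting chain stays in the band and costs no more than the length of [v]. *)
Lemma band_cost_almost_geodesic (S X : set G) :
  symmetric_generating_set S -> symmetric_generating_set X ->
  exists2 B : seq G, 1%g \in B & forall w, almost_geodesic_word S w ->
    band_cost X B w 1%g = word_length X (word_prod w).
Proof.
move=> hS hX; have [K [K' hK]] := monotone_matching h0 hS hX d4.
have [B BE] := ball_enum h0 K'; exists B; first by rewrite BE word_length1.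
move=> w gw; apply/eqP; rewrite eqn_leq andbC.
have := band_cost_ge B hX w 1%g; rewrite mulg1 => -> /=.
have [v [gv pv sv]] := geodesic_word_of (word_prod w) hX.
have vX := gv.1.
have [near mono] := hK w v gw gv (esym pv).
have exj i : exists j, (i <= size w)%N -> (j <= size v)%N /\
    (word_dist S0 (path_of_word w i) (path_of_word v j) <= K)%N.
  case: (leqP i (size w)) => [/near[j jv ij]|_]; last by exists 0%N.
  by exists j.
have [J hJ] := choice exj.
(* The matching [J] need not be monotone, so the chain uses its running maximum, attained at
   [i']. *)
have main i : (i <= size w)%N -> exists i', [/\ (i' <= i)%N, (J i <= J i')%N &
    (band_cost X B (take i w) ((path_of_word w i)^-1 * path_of_word v (J i'))%g <= J i')%N].
  elim: i => [|i IH] iw.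
    exists 0%N; split=> //; rewrite take0 /path_of_word take0 word_prod_nil invg1 mul1g.
    have [Jv _] := hJ 0%N iw.
    apply: leq_trans (word_length_le hX _) _; first by move=> s /mem_take; apply: vX.
    by rewrite size_take_min geq_minl.
  have [i' [ii Ji cost]] := IH (ltnW iw).
  have [Jv _] := hJ i' (leq_trans ii (ltnW iw)); have [_ di] := hJ i (ltnW iw).
  have [_ di'] := hJ i' (leq_trans ii (ltnW iw)).
  have kB : ((path_of_word w i)^-1 * path_of_word v (J i'))%g \in B.
    by rewrite BE; apply: (mono i' i (J i)) => //; rewrite ?ii ?Ji // ltnW.
  have wi : take i.+1 w = rcons (take i w) (nth 1%g w i) by rewrite (take_nth 1%g).
  have step j : (J i' <= j <= size v)%N ->
      (band_cost X B (take i.+1 w) ((path_of_word w i.+1)^-1 * path_of_word v j)%g <= j)%N.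
    move=> /andP[ij jv]; rewrite wi band_cost_rcons.
    apply: leq_trans (band_step_le _ _ _ _ kB) _.
    rewrite /path_of_word wi -cats1 word_prod_cat word_prod1.
    rewrite !invgM invgK -!mulgA !mulVKg.
    by apply: leq_trans (leq_add cost (word_dist_prefix hX vX ij)) _; rewrite subnKC.
  case: (leqP (J i') (J i.+1)) => JJ.
    exists i.+1; split=> //; apply: step; rewrite JJ.
    by have [] := hJ i.+1 iw.
  by exists i'; split; [exact: leqW|exact: ltnW|apply: step; rewrite leqnn].
have [i' [iw' _]] := main (size w) (leqnn _).
have [Jv _] := hJ i' iw'.
rewrite take_size /path_of_word take_size => cost.
(* The chain ends at index [J i'] of [v]; the last jump covers the rest of [v]. *)
apply: leq_trans (band_cost_lipschitz B hX w 1%g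
  ((word_prod w)^-1 * word_prod (take (J i') v))%g) _.
have := leq_add cost (word_dist_prefix hX vX Jv).
by rewrite /word_dist take_size pv mulg1 invgM invgK subnKC // sv.
Qed.

Lemma finite_length_state (S X : set G) :
  symmetric_generating_set S -> symmetric_generating_set X ->
  exists (Q : finType) (st : seq G -> Q), forall w w',
    st w = st w' -> almost_geodesic_word S w -> almost_geodesic_word S w' ->
    forall v, almost_geodesic_word S (w ++ v) -> almost_geodesic_word S (w' ++ v) ->
    (word_length X (word_prod (w ++ v)) + word_length X (word_prod w') =
     word_length X (word_prod (w' ++ v)) + word_length X (word_prod w))%N.
Proof.
move=> hS hX; have [B B1 cost] := band_cost_almost_geodesic hS hX.
have [Q [st stE]] := finite_band_state hX B1.
exists Q, st => w w' /stE eqw gw gw' v gwv gwv'.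
by rewrite -!cost //; apply: band_cost_shift.
Qed.

(** Tracking the length over [S] as well decides which continuations are geodesic. A geodesic word
    with one more letter is only known to be almost geodesic, which is why the length states must
    cover such words. *)
Lemma finite_geodesic_state (S X : set G) :
  symmetric_generating_set S -> symmetric_generating_set X ->
  exists (Q : finType) (st : seq G -> Q), forall w w',
    st w = st w' -> geodesic_word S w -> geodesic_word S w' ->
    forall v, geodesic_word S (w ++ v) -> geodesic_word S (w' ++ v) /\
    (word_length X (word_prod (w ++ v)) + word_length X (word_prod w') =
     word_length X (word_prod (w' ++ v)) + word_length X (word_prod w))%N.
Proof.
move=> hS hX; have [Q1 [st1 st1E]] := finite_length_state hS hS.
have [Q2 [st2 st2E]] := finite_length_state hS hX.
exists (Q1 * Q2)%type, (fun w => (st1 w, st2 w)) => w w' [e1 e2] gw gw' v gwv.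
have gwv' : geodesic_word S (w' ++ v).
  elim/last_ind: v gwv => [|v s IH]; first by rewrite !cats0.
  rewrite -!rcons_cat => gws.
  have gwv' : geodesic_word S (w' ++ v).
    by apply/IH/(@geodesic_word_catl _ _ _ [:: s]); rewrite ?cats1.
  have Ss : S s by apply: gws.1; rewrite mem_rcons mem_head.
  have al := almost_geodesic_rcons hS gwv' Ss.
  split; first exact: al.1.
  have := st1E w w' e1 (geodesic_word_almost gw) (geodesic_word_almost gw') (rcons v s).
  rewrite -!rcons_cat => /(_ (geodesic_word_almost gws) al).
  rewrite gws.2 gw.2 gw'.2 !size_rcons !size_cat; lia.
by split=> //; apply: st2E => //; apply: geodesic_word_almost.
Qed.
End FiniteStates.

(** * Cycles of maximal ratio *)

Section MaximalCycleRatio.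
Variables (A : Type) (Q : finType) (st : seq A -> Q).
Variables (P : seq A -> Prop) (val : seq A -> int) (L : nat).
Hypothesis P_catl : forall w v, P (w ++ v) -> P w.
Hypothesis st_eq : forall w w', st w = st w' -> P w -> P w' ->
  forall v, P (w ++ v) -> P (w' ++ v) /\ val (w ++ v) + val w' = val (w' ++ v) + val w.
Hypothesis val_lipschitz : forall w v, P (w ++ v) ->
  `|val (w ++ v) - val w| <= L%:Z * (size v)%:Z.
Hypothesis P_long : forall n, exists2 w, P w & size w = n.

Let N := #|Q|.

(** A loop of the automaton read after [w]; bounding its length leaves finitely many possible
    ratios. *)
Definition state_cycle (w u : seq A) : Prop :=
  [/\ P (w ++ u), (0 < size u <= N)%N & st w = st (w ++ u)].

Lemma cycle_ex w : P w -> (N <= size w)%N ->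
  exists w1 u w2, w = w1 ++ u ++ w2 /\ state_cycle w1 u.
Proof.
move=> Pw Nw.
(* Pigeonhole on the [N + 1] shortest prefixes. *)
have /injectivePn[i [j ij e]] : ~~ injectiveb (fun i : 'I_N.+1 => st (take i w)).
  apply/negP => /injectiveP/leq_card; rewrite card_ord -/N; lia.
wlog {ij} ij : i j e / (i < j)%N.
  move=> H; case: (ltngtP i j) => h; [exact: (H i j)|exact: (H j i)|].
  by move/eqP: ij; case; apply: val_inj.
have jw : (j <= size w)%N by have := ltn_ord j; lia.
have jE : take j w = take i w ++ take (j - i) (drop i w).
  by rewrite -takeD subnKC // ltnW.
exists (take i w), (take (j - i) (drop i w)), (drop j w).
split; first by rewrite catA -jE cat_take_drop.
split; rewrite -?jE //.
  by apply: (@P_catl _ (drop j w)); rewrite cat_take_drop.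
by rewrite size_takel ?size_drop; have := ltn_ord j; lia.
Qed.

Lemma maximal_cycle : exists w u, state_cycle w u /\ forall w' u', state_cycle w' u' ->
  (val (w' ++ u') - val w') * (size u)%:Z <= (val (w ++ u) - val w) * (size u')%:Z.
Proof.
(* A cycle is recorded by its length and its gain; the gain is shifted by [L * N] to become a
   natural number. *)
pose real (a : 'I_(2 * (L * N)).+1 * 'I_N.+1) (w u : seq A) :=
  [/\ state_cycle w u, size u = a.2 & val (w ++ u) - val w = a.1%:Z - (L * N)%:Z].
have realE w u : state_cycle w u -> exists a, real a w u.
  move=> c; have [Pwu uN _] := c.
  have := val_lipschitz Pwu; set k : int := val _ - _ => kL.
  have kLN : `|k| <= (L * N)%:Z.
    by apply: le_trans kL _; rewrite PoszM ler_wpM2l //; lia.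
  exists (inord (absz (k + (L * N)%:Z)), inord (size u)); split=> //=.
    by rewrite inordK //; lia.
  by rewrite inordK; lia.
pose rat_of (a : 'I_(2 * (L * N)).+1 * 'I_N.+1) : rat :=
  (a.1%:Z - (L * N)%:Z)%:~R / (a.2 : nat)%:R.
have [w0 Pw0 sw0] := P_long N.
have [w1 [u1 [_ [_ c1]]]] := cycle_ex Pw0 (eq_leq (esym sw0)).
have [a1 r1] := realE w1 u1 c1.
pose good a := `[< exists w u, real a w u >].
have good1 : good a1 by apply/asboolP; exists w1, u1.
case: (arg_maxP rat_of good1) => a /asboolP[w [u [c su vu]]] amax.
exists w, u; split=> // w' u' c'.
have [a' r'] := realE w' u' c'; have [_ su' vu'] := r'.
have : rat_of a' <= rat_of a by apply: amax; apply/asboolP; exists w', u'.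
have [_ /andP[u0 _] _] := c; have [_ /andP[u0' _] _] := c'.
rewrite /rat_of vu vu' -su -su' ler_pdivrMr ?ltr0n // mulrAC ler_pdivlMr ?ltr0n //.
by rewrite !pmulrn -!intrM ler_int.
Qed.

(** As [w] and [w ++ u] have the same state, a continuation of [w] also continues [w ++ u], with the
    same gain. *)
Lemma cycle_iter w u p : state_cycle w u ->
  P (w ++ u ++ flatten (nseq p u)) /\
  val (w ++ u ++ flatten (nseq p u)) = val w + (p.+1)%:Z * (val (w ++ u) - val w).
Proof.
move=> [Pwu _ e]; have Pw := P_catl Pwu.
elim: p => [|p [Pp Vp]]; first by rewrite /= cats0 mul1r addrC subrK.
have [Pp' e'] := st_eq e Pw Pwu Pp.
rewrite [flatten _]/= catA; split=> //; apply: (addIr (val w)).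
by rewrite -e' Vp -[p.+2]addn1 PoszD; ring.
Qed.

(* Deleting a cycle from a long word, or iterating the cycle of maximal ratio,
   changes val and size proportionally. *)
Lemma maximal_cycle_ratio : exists (c : int) (l : nat) (C : int), [/\ (0 < l)%N,
  forall w, P w -> val w * l%:Z <= c * (size w)%:Z + C &
  forall n, exists w, [/\ P w, (n <= size w)%N &
    c * (size w)%:Z <= val w * l%:Z + C]].
Proof.
have [w0 [u0 [cyc max]]] := maximal_cycle.
pose c := val (w0 ++ u0) - val w0; pose l := size u0.
have [_ /andP[l0 lN] _] := cyc.
(* [C] covers the words shorter than [N], where the deletion of cycles stops; the term added below
   accounts for the prefix [w0] of the iterated cycle. *)
pose C := (`|val [::]| + (L * N)%:Z) * l%:Z + `|c| * N%:Z.
exists c, l, (C + `|c * (size w0)%:Z - val w0 * l%:Z|); split=> //.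
  suff H w : P w -> val w * l%:Z <= c * (size w)%:Z + C.
    by move=> w /H; lia.
  have [n] := ubnP (size w); elim: n w => // n IH w; rewrite ltnS => wn Pw.
  case: (leqP N (size w)) => Nw; last first.
    have Vw := @val_lipschitz [::] w Pw.
    have h1 : val w <= `|val [::]| + (L * N)%:Z.
      have : L%:Z * (size w)%:Z <= (L * N)%:Z by rewrite PoszM ler_wpM2l //; lia.
      by move: Vw; rewrite /=; lia.
    have h2 : val w * l%:Z <= (`|val [::]| + (L * N)%:Z) * l%:Z by rewrite ler_wpM2r.
    have h3 : - (c * (size w)%:Z) <= `|c| * N%:Z.
      apply: le_trans (ler_norm _) _; rewrite normrN normrM ler_wpM2l //; lia.
    by rewrite /C; lia.
  have [w1 [u [w2 [wE cyc']]]] := cycle_ex Pw Nw.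
  have [Pu /andP[u_gt0 _] e] := cyc'.
  have Pw' : P ((w1 ++ u) ++ w2) by rewrite -catA -wE.
  have [Pw12 eV] := st_eq (esym e) Pu (P_catl Pu) Pw'.
  have := IH (w1 ++ w2) _ Pw12; have := max w1 u cyc'.
  have sw : size w = (size (w1 ++ w2) + size u)%N by rewrite wE !size_cat; lia.
  rewrite wE catA -/c -/l => h1 h2.
  have {}h2 : val (w1 ++ w2) * l%:Z <= c * (size (w1 ++ w2))%:Z + C by apply: h2; lia.
  have -> : val ((w1 ++ u) ++ w2) = val (w1 ++ w2) + (val (w1 ++ u) - val w1) by lia.
  rewrite -catA -wE sw PoszD mulrDl mulrDr; lia.
move=> n; have [Pn Vn] := cycle_iter n cyc.
exists (w0 ++ u0 ++ flatten (nseq n u0)).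
have sz : size (w0 ++ u0 ++ flatten (nseq n u0)) = (size w0 + n.+1 * l)%N.
  rewrite !size_cat size_flatten /shape map_nseq sumn_nseq -/l; lia.
split=> //; first by rewrite sz; nia.
rewrite sz Vn -/c PoszD PoszM.
have C0 : 0 <= C by rewrite /C; nia.
have -> : c * ((size w0)%:Z + n.+1%:Z * l%:Z) = c * (size w0)%:Z + n.+1%:Z * c * l%:Z by ring.
rewrite mulrDl; lia.
Qed.
End MaximalCycleRatio.

(** * Growth rates *)

Section GrowthRate.
Variable R : realType.
Implicit Types (u v : nat -> R) (l : R).

(** A division-free form of the convergence of [u n / n] to [l]. *)
Definition growth_rate u l : Prop := forall e, 0 < e ->
  exists K, forall n, `|u n - l * n%:R| <= e * n%:R + K.

Lemma growth_rate_cvg u l : growth_rate u l -> (n%:R^-1 * u n) @[n --> \oo] --> l.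
Proof.
move=> ul; apply/cvgrPdist_le => e e0.
have [K hK] := ul (e / 2) ltac:(by rewrite divr_gt0).
near=> n; have n0 : 0 < n%:R :> R by rewrite ltr0n; near: n; exists 1%N.
have -> : l - n%:R^-1 * u n = n%:R^-1 * (l * n%:R - u n).
  by rewrite mulrBr mulrCA mulVf ?gt_eqF // mulr1.
rewrite normrM (ger0_norm (ltW _)) ?invr_gt0 // mulrC ler_pdivrMr // distrC.
apply: le_trans (hK n) _; suff : K <= e / 2 * n%:R by lra.
rewrite mulrC -ler_pdivrMr ?divr_gt0 //; near: n; exact: nbhs_infty_ger.
Unshelve. all: by end_near.
Qed.

Lemma le0_of_frequently (x K : R) :
  (forall N, exists2 n, (N <= n)%N & x * n%:R <= K) -> x <= 0.
Proof.
move=> h; rewrite leNgt; apply/negP => x0.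
have [n Nn] := h (Num.bound (`|K| / x)); apply/negP; rewrite -ltNge.
apply: le_lt_trans (ler_norm _) _; rewrite mulrC -ltr_pdivrMr //.
apply: lt_le_trans (archi_boundP _) _; last by rewrite ler_nat.
by rewrite divr_ge0 // ltW.
Qed.

(** Since the rate exists, a lower bound along a subsequence suffices; iterated cycles provide just
    that. *)
Lemma growth_rate_ge u l b K : growth_rate u l ->
  (forall N, exists2 n, (N <= n)%N & b * n%:R <= u n + K) -> b <= l.
Proof.
move=> ul h; apply/ler_addgt0Pr => e e0; have [K' hK'] := ul e e0.
rewrite -subr_le0; apply: (@le0_of_frequently _ (K + K')) => N.
have [n Nn hn] := h N; exists n => //; have := hK' n; rewrite ler_norml.
move: hn; lra.
Qed.

Lemma growth_rate_le u v l l' b K : growth_rate u l -> growth_rate v l' ->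
  (forall n, u n <= v n + b * n%:R + K) -> l <= l' + b.
Proof.
move=> ul vl h; apply/ler_addgt0Pr => e e0.
have [K1 h1] := ul (e / 2) ltac:(by rewrite divr_gt0).
have [K2 h2] := vl (e / 2) ltac:(by rewrite divr_gt0).
rewrite -subr_le0; apply: (@le0_of_frequently _ (K + K1 + K2)) => N.
exists N => //; have := h1 N; have := h2 N; have := h N; rewrite !ler_norml; lra.
Qed.

Lemma subadditive_iter v : (forall n m, v (n + m)%N <= v n + v m) ->
  forall q m r, v (q * m + r)%N <= q%:R * v m + v r.
Proof.
move=> sub q m r; elim: q => [|q IH]; first by rewrite mul0n mul0r add0r.
rewrite mulSn -addnA; apply: le_trans (sub _ _) _.
by rewrite -natr1; lra.
Qed.

(** The rate is the infimum of [v n / n] over positive [n]: [n] is divided with remainder by an [m]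
    that nearly attains it. *)
Lemma subadditive_growth_rate v b :
  (forall n m, v (n + m)%N <= v n + v m) -> (forall n, b * n%:R <= v n) ->
  exists l, growth_rate v l.
Proof.
move=> sub bd; pose A := [set v n.+1 / n.+1%:R | n in [set: nat]].
have hA : has_inf A.
  split; first by exists (v 1%N / 1), 0%N.
  by exists b => _ [n _ <-]; rewrite ler_pdivlMr ?ltr0n.
exists (inf A) => e e0.
have [_ [m' _ <-] hm] := inf_adherent e0 hA; set m := m'.+1 in hm.
have m0 : 0 < m%:R :> R by rewrite ltr0n.
pose s := v m / m%:R.
pose M : R := \sum_(r < m) `|v r|.
exists (`|s| * m%:R + M + `|v 0%N|) => n; rewrite ler_norml; apply/andP; split.
  have low : inf A * n%:R <= v n + `|v 0%N|.
    case: n => [|n]; first by rewrite mulr0; have := ler_norm (- v 0%N); rewrite normrN; lra.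
    have : inf A <= v n.+1 / n.+1%:R by apply: ge_inf; [case: hA|exists n].
    by rewrite ler_pdivlMr ?ltr0n //; have := normr_ge0 (v 0%N); lra.
  have M0 : 0 <= M by apply: sumr_ge0.
  have : 0 <= e * n%:R by rewrite mulr_ge0 // ltW.
  have : 0 <= `|s| * m%:R by rewrite mulr_ge0 // ltW.
  lra.
have := subadditive_iter sub (n %/ m)%N m (n %% m)%N; rewrite -divn_eq.
have rm : (n %% m < m)%N by rewrite ltn_mod.
have vr : v (n %% m)%N <= M.
  apply: le_trans (ler_norm _) _.
  by rewrite /M (bigD1 (Ordinal rm)) //= lerDl sumr_ge0.
have vm : (n %/ m)%N%:R * v m = s * n%:R - s * (n %% m)%N%:R.
  have -> : n%:R = (n %/ m)%N%:R * m%:R + (n %% m)%N%:R :> R.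
    by rewrite -natrM -natrD -divn_eq.
  have -> : v m = s * m%:R by rewrite /s divfK // gt_eqF.
  by ring.
have sr : - (s * (n %% m)%N%:R) <= `|s| * m%:R.
  apply: le_trans (ler_norm _) _; rewrite normrN normrM ler_wpM2l //.
  by rewrite normr_nat ler_nat ltnW.
have sn : s * n%:R <= (inf A + e) * n%:R by rewrite ler_wpM2r // ltW.
by have := normr_ge0 (v 0%N); lra.
Qed.

Lemma fekete u C b :
  (forall n m, u (n + m)%N <= u n + u m + C) -> (forall n, b * n%:R <= u n) ->
  exists l, growth_rate u l.
Proof.
move=> sub bd.
have [n m|n|l hl] := @subadditive_growth_rate (fun n => u n + `|C|) b.
- by have := sub n m; have := ler_norm C; lra.
- by have := bd n; have := normr_ge0 C; lra.
exists l => e e0; have [K hK] := hl e e0; exists (K + `|C|) => n.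
have -> : u n - l * n%:R = (u n + `|C| - l * n%:R) - `|C| by ring.
by apply: le_trans (ler_normB _ _) _; rewrite normr_id; have := hK n; lra.
Qed.

Lemma affine_slope_pinfty (theta : R -> R) (b M : R) :
  (forall t, 0 <= t -> t * b <= theta t <= M + t * b) ->
  theta t / t @[t --> +oo] --> b.
Proof.
move=> h; apply/cvgrPdist_le => e e0; near=> t.
have t0 : 0 < t by near: t; exact: nbhs_pinfty_gt.
have -> : b - theta t / t = (b * t - theta t) / t by rewrite mulrBl mulfK ?gt_eqF.
have Me : `|M| <= e * t.
  by rewrite mulrC -ler_pdivrMr //; near: t; exact: nbhs_pinfty_ge.
rewrite normrM normfV (gtr0_norm t0) ler_pdivrMr // ler_norml.
by have := h t (ltW t0); have := ler_norm M; have := normr_ge0 M; lra.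
Unshelve. all: by end_near.
Qed.

Lemma affine_slope_ninfty (theta : R -> R) (b M : R) :
  (forall t, 0 <= t -> t * b <= theta (- t) <= M + t * b) ->
  theta t / t @[t --> -oo] --> - b.
Proof.
move=> /affine_slope_pinfty h; apply/cvgNy_compNP.
have -> : (fun t => theta t / t) \o -%R = (fun t => - (theta (- t) / t)).
  by apply/funext => t /=; rewrite invrN mulrN.
exact: cvgN.
Qed.
End GrowthRate.

(** * The Manhattan curve *)

Lemma ler_sum_subset (R : numDomainType) (T : eqType) (s t : seq T) (f : T -> R) :
  (forall x, 0 <= f x) -> uniq s -> {subset s <= t} ->
  \sum_(x <- s) f x <= \sum_(x <- t) f x.
Proof.
move=> f0; elim: s t => [|x s IH] t /=; first by rewrite big_nil sumr_ge0.
move=> /andP[xs us] st; rewrite big_cons (big_rem x (r := t)) ?st ?mem_head //=.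
rewrite lerD2l; apply: IH => // y ys; apply: rem_mem.
  by apply: contraNneq xs => <-.
by apply: st; rewrite inE ys orbT.
Qed.

Section ManhattanSums.
Variables (R : realType) (G : groupType) (S X : set G).
Hypotheses (hS : symmetric_generating_set S) (hX : symmetric_generating_set X).

Let A n := fset_set (sphere S n).
Let F (a : R) (x : G) : R := expR (- a * (word_length X x)%:R).

Lemma finite_sphere n : finite_set (sphere S n).
Proof. by apply: sub_finite_set (finite_ball hS n) => x /= ->. Qed.

Lemma mem_sphere_enum n x : (x \in A n) = (word_length S x == n).
Proof.
rewrite in_fset_set; last exact: finite_sphere.
by apply/idP/eqP => [/set_mem|h]; last exact/mem_set.
Qed.

Lemma manhattan_sumE (a : R) n : manhattan_sum S X a n = \sum_(x <- A n) F a x.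
Proof. by rewrite /manhattan_sum fsbig_finite //; exact: finite_sphere. Qed.

Lemma manhattan_sum_ge (a : R) x :
  expR (- a * (word_length X x)%:R) <= manhattan_sum S X a (word_length S x).
Proof.
rewrite manhattan_sumE (big_rem x) /=; last by rewrite mem_sphere_enum.
by rewrite lerDl sumr_ge0 // => y _; exact: expR_ge0.
Qed.

(** The sum at parameter 0 counts the elements of the sphere. *)
Lemma manhattan_sum_le (a : R) n b :
  (forall x, word_length S x = n -> - a * (word_length X x)%:R <= b) ->
  manhattan_sum S X a n <= manhattan_sum S X 0 n * expR b.
Proof.
move=> h; rewrite !manhattan_sumE mulr_suml big_seq [leRHS]big_seq.
apply: ler_sum => x; rewrite mem_sphere_enum => /eqP/h.
by rewrite /F oppr0 mul0r expR0 mul1r ler_expR.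
Qed.

(* Splitting a geodesic after n letters embeds the sphere of radius n + m in
   the product of those of radii n and m. *)
Lemma manhattan_sum_submultiplicative (a C : R) n m :
  (forall x y, word_length S (x * y)%g = (word_length S x + word_length S y)%N ->
     - a * (word_length X (x * y)%g)%:R <=
     - a * (word_length X x)%:R - a * (word_length X y)%:R + C) ->
  manhattan_sum S X a (n + m) <=
    manhattan_sum S X a n * manhattan_sum S X a m * expR C.
Proof.
move=> qa.
have ex x : exists yz : G * G, word_length S x = (n + m)%N ->
    [/\ x = (yz.1 * yz.2)%g, word_length S yz.1 = n & word_length S yz.2 = m].
  have [w [wS sw pw]] := geodesic_word_ex hS x.
  exists (word_prod (take n w), word_prod (drop n w)) => xnm /=.
  have pE : (word_prod (take n w) * word_prod (drop n w))%g = x.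
    by rewrite -word_prod_cat cat_take_drop.
  have [tS dS] : word_over S (take n w) /\ word_over S (drop n w).
    by apply/word_over_cat; rewrite cat_take_drop.
  have h1 := word_length_le hS tS; have h2 := word_length_le hS dS.
  have := word_lengthM hS (word_prod (take n w)) (word_prod (drop n w)).
  rewrite pE xnm; move: h1 h2; rewrite size_drop size_takel ?sw xnm ?leq_addr //.
  by split=> //; lia.
have [sp spE] := choice ex.
rewrite !manhattan_sumE.
have -> : (\sum_(x <- A n) F a x) * (\sum_(x <- A m) F a x) * expR C =
    \sum_(yz <- [seq (y, z) | y <- A n, z <- A m]) F a yz.1 * F a yz.2 * expR C.
  rewrite big_allpairs mulr_suml mulr_suml; apply: eq_bigr => y _.
  by rewrite mulr_sumr mulr_suml.
apply: (@le_trans _ _ (\sum_(yz <- [seq sp x | x <- A (n + m)])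
    F a yz.1 * F a yz.2 * expR C)).
  rewrite big_map big_seq [leRHS]big_seq; apply: ler_sum => x.
  rewrite mem_sphere_enum => /eqP xnm; have [xE h1 h2] := spE x xnm.
  rewrite /F -!expRD ler_expR {1}xE.
  by have := qa (sp x).1 (sp x).2; rewrite -xE xnm h1 h2 mulNr => /(_ erefl); lra.
apply: ler_sum_subset => [yz||yz /mapP[x]].
- by rewrite !mulr_ge0 ?expR_ge0.
- rewrite map_inj_in_uniq ?fset_uniq // => x y.
  rewrite !mem_sphere_enum => /eqP/spE[xE _ _] /eqP/spE[yE _ _] e.
  by rewrite xE yE e.
rewrite mem_sphere_enum => /eqP/spE[_ h1 h2] ->.
rewrite [sp x]surjective_pairing.
by apply/allpairsP; exists (sp x); rewrite /= !mem_sphere_enum h1 h2.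
Qed.

End ManhattanSums.

Section ManhattanCurve.
Variables (R : realType) (G : groupType) (S0 S X : set G) (delta : nat).
Hypotheses (h0 : symmetric_generating_set S0) (d4 : four_point (word_dist S0) delta).
Hypotheses (hS : symmetric_generating_set S) (hX : symmetric_generating_set X).

Let u (a : R) (n : nat) : R := ln (manhattan_sum S X a n).

Lemma word_length_prefix_ex x n : (n <= word_length S x)%N ->
  exists y, word_length S y = n.
Proof.
have [w [gw wx sw]] := geodesic_word_of x hS; rewrite -sw => nw.
have : geodesic_word S (take n w ++ drop n w) by rewrite cat_take_drop.
by move=> /(geodesic_word_catl hS)[_ h]; exists (word_prod (take n w)); rewrite h size_takel.
Qed.

(** An empty sphere makes all larger ones empty; their sums vanish, and [ln 0] is 0 by
    convention. *)
Lemma manhattan_curve_bounded :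
  ~ (forall n, exists x, word_length S x = n) -> forall a : R, manhattan_curve S X a = 0.
Proof.
move=> nex a; have [N hN] : exists N, forall x, word_length S x <> N.
  apply: contrapT => h; apply: nex => n; apply: contrapT => h'; apply: h.
  by exists n => x xn; apply: h'; exists x.
apply: cvg_lim => //; apply/cvgrPdist_le => e e0; near=> n.
have Nn : (N <= n)%N by near: n; exact: nbhs_infty_ge.
suff -> : manhattan_sum S X a n = 0 by rewrite ln0 // mulr0 subr0 normr0 ltW.
rewrite /manhattan_sum fsbig1 // => x /= xn.
have [y yN] : exists y, word_length S y = N by apply: (@word_length_prefix_ex x); rewrite xn.
by have := hN y.
Unshelve. all: by end_near.
Qed.

Section Unbounded.
Hypothesis S_ex : forall n, exists x, word_length S x = n.

Lemma manhattan_sum_gt0 a n : 0 < manhattan_sum S X a n :> R.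
Proof.
have [x <-] := S_ex n; apply: lt_le_trans (manhattan_sum_ge _ hS _ _).
exact: expR_gt0.
Qed.

Lemma ln_manhattan_sum_ge a x :
  - a * (word_length X x)%:R <= u a (word_length S x).
Proof.
rewrite -[leLHS]expRK ler_ln ?posrE ?expR_gt0 ?manhattan_sum_gt0 //.
exact: manhattan_sum_ge.
Qed.

Lemma manhattan_curve_growth_rate a : growth_rate (u a) (manhattan_curve S X a).
Proof.
suff [l hl] : exists l, growth_rate (u a) l.
  by rewrite /manhattan_curve (cvg_lim _ (growth_rate_cvg hl)).
have [C hC] := word_length_quasi_additive h0 hS hX d4.
have [L hL] := word_length_compare hS hX.
apply: (@fekete _ _ (`|a| * C%:R) (- `|a| * L%:R)) => [n m|n].
  rewrite /u -lnM ?posrE ?manhattan_sum_gt0 //.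
  rewrite -[ `|a| * _]expRK -lnM ?posrE ?mulr_gt0 ?manhattan_sum_gt0 ?expR_gt0 //.
  rewrite ler_ln ?posrE ?mulr_gt0 ?manhattan_sum_gt0 ?expR_gt0 //.
  apply: manhattan_sum_submultiplicative => // x y xy.
  have := hC x y xy; have := word_lengthM hX x y.
  rewrite -!(ler_nat R) !natrD => h1 h2.
  (* The defect [d] lies between 0 and [C], so [a * d] is at most [|a| * C] for either sign of
     [a]. *)
  pose d : R := (word_length X x)%:R + (word_length X y)%:R - (word_length X (x * y)%g)%:R.
  have : a * d <= `|a| * C%:R.
    apply: le_trans (ler_norm _) _; rewrite normrM ler_wpM2l //.
    by rewrite ger0_norm /d; lra.
  by rewrite /d; lra.
have [x <-] := S_ex n; apply: le_trans (ln_manhattan_sum_ge a x).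
have := hL x; rewrite -(ler_nat R) natrM => h.
rewrite !mulNr lerN2 -mulrA; apply: le_trans (ler_wpM2l (normr_ge0 a) h).
by rewrite ler_wpM2r // ler_norm.
Qed.

(** The sign [z] treats both ends of the curve at once: at parameter [- z * t] the exponent of a
    term is [t] times [val], whose maximal cycle ratio is [q]. *)
Lemma manhattan_curve_ray (z : int) : `|z| = 1 -> exists q : rat, forall t : R, 0 <= t ->
  t * ratr q <= manhattan_curve S X (- z%:~R * t) <= manhattan_curve S X 0 + t * ratr q.
Proof.
move=> z1; have [L hL] := word_length_compare hS hX.
have [Q [st stE]] := finite_geodesic_state h0 d4 hS hX.
pose val (w : seq G) : int := z * (word_length X (word_prod w))%:Z.
have [] := @maximal_cycle_ratio _ _ st (geodesic_word S) val L.
- by move=> w v; exact: geodesic_word_catl.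
- move=> w w' ww gw gw' v gwv; have [gwv' e] := stE w w' ww gw gw' v gwv.
  by split=> //; rewrite /val -!mulrDr -!PoszD e.
- move=> w v [/word_over_cat[_ vS] _]; rewrite /val -mulrBr normrM z1 mul1r.
  have := leq_trans (hL (word_prod v)) (leq_mul (leqnn L) (word_length_le hS vS)).
  rewrite word_prod_cat -PoszM => h.
  have h1 := word_lengthM hX (word_prod w) (word_prod v).
  have := word_lengthM hX (word_prod w * word_prod v)%g (word_prod v)^-1%g.
  rewrite mulgK word_lengthV // => h2.
  rewrite ler_norml; apply/andP; split; lia.
- move=> n; have [x <-] := S_ex n.
  by have [w [gw _ sw]] := geodesic_word_of x hS; exists w.
move=> c [l [C [l0 up low]]]; exists (c%:~R / l%:R) => t t0.
have lR : 0 < l%:R :> R by rewrite ltr0n.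
set q : R := ratr _; have ql : q * l%:R = c%:~R.
  by rewrite /q fmorph_div rmorph_int rmorph_nat divfK // gt_eqF.
have aE x : - (- z%:~R * t) * (word_length X x)%:R =
    t * (z * (word_length X x)%:Z)%:~R :> R by rewrite intrM; ring.
apply/andP; split.
  apply: (growth_rate_ge (K := t * (C%:~R / l%:R)) (manhattan_curve_growth_rate _)) => N.
  have [w [gw Nw hw]] := low N; exists (size w) => //; rewrite -{2}gw.2.
  apply: le_trans (lerD (ln_manhattan_sum_ge _ _) (lexx _)).
  rewrite aE -mulrA -mulrDr ler_wpM2l // -(ler_pM2r lR) mulrDl divfK ?gt_eqF //.
  rewrite mulrAC ql; move: hw; rewrite -(ler_int R) intrD !intrM.
  by rewrite -!pmulrn.
apply: (growth_rate_le (manhattan_curve_growth_rate _) (manhattan_curve_growth_rate _)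
  (K := t * (C%:~R / l%:R))) => n.
rewrite -addrA -[t * q * _ + _]expRK /u -lnM ?posrE ?manhattan_sum_gt0 ?expR_gt0 //.
rewrite ler_ln ?posrE ?mulr_gt0 ?manhattan_sum_gt0 ?expR_gt0 //.
apply: manhattan_sum_le => // x xn; rewrite aE -mulrA -mulrDr ler_wpM2l //.
rewrite -(ler_pM2r lR) mulrDl divfK ?gt_eqF // mulrAC ql.
have [w [gw wx sw]] := geodesic_word_of x hS.
have := up w gw; rewrite /val wx sw xn -(ler_int R) intrD !intrM.
by rewrite -!pmulrn.
Qed.
End Unbounded.
End ManhattanCurve.

Lemma manhattan_curve_asymptotic_ray (R : realType) (G : groupType) (S X : set G) :
  hyperbolic_group R G ->
  symmetric_generating_set S -> symmetric_generating_set X ->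
  forall z : int, `|z| = 1 -> exists q : rat, forall t : R, 0 <= t ->
  t * ratr q <= manhattan_curve S X (- z%:~R * t) <= manhattan_curve S X 0 + t * ratr q.
Proof.
move=> [S0 [h0 /(gromov_hyperbolic_four_point h0)[delta d4]]] hS hX z z1.
have [ex|nex] := pselect (forall n, exists x, word_length S x = n).
  exact: manhattan_curve_ray h0 d4 hS hX ex z z1.
exists 0 => t _; rewrite rmorph0 mulr0 addr0.
by rewrite !(manhattan_curve_bounded _ hS nex) lexx.
Qed.

Theorem proposition4p22 (R : realType) (G : groupType)
    (hG : non_elementary_hyperbolic R G) (S Sstar : set G)
    (hS : symmetric_generating_set S) (hSstar : symmetric_generating_set Sstar) :
  let theta : R -> R := @manhattan_curve R G S Sstar in
  let amin : R := @alpha_min R G S Sstar in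
  let amax : R := @alpha_max R G S Sstar in
  [/\ theta = (fun t => - amin * t) +O_ +oo (fun=> 1 : R),
      theta = (fun t => - amax * t) +O_ -oo (fun=> 1 : R),
      exists q : rat, amin = ratr q &
      exists q : rat, amax = ratr q].
Proof.
move=> theta amin amax; have [hyp _] := hG.
have [p hp] := manhattan_curve_asymptotic_ray hyp hS hSstar (z := -1) ltac:(by rewrite normrN1).
have [q hq] := manhattan_curve_asymptotic_ray hyp hS hSstar (z := 1) (normr1 _).
have {}hp t : 0 <= t -> t * ratr p <= theta t <= theta 0 + t * ratr p.
  by move/hp; rewrite mulrN1z opprK mul1r.
have {}hq t : 0 <= t -> t * ratr q <= theta (- t) <= theta 0 + t * ratr q.
  by move/hq; rewrite mulr1z mulN1r.
have minE : amin = - ratr p.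
  by rewrite /amin /alpha_min; congr (- _); apply: cvg_lim (affine_slope_pinfty hp).
have maxE : amax = ratr q.
  rewrite /amax /alpha_max -[RHS]opprK; congr (- _).
  exact: cvg_lim (affine_slope_ninfty hq).
have theta0 : 0 <= theta 0 by have := hp 0 (lexx 0); rewrite mul0r => /andP[].
split; last 2 first.
- by exists (- p); rewrite minE rmorphN.
- by exists q.
(* The difference from the linear function lies between 0 and [theta 0], which serves as implied
   constant at both ends. *)
- apply/eqaddOP; near=> k => /=.
  have k0 : theta 0 <= k by near: k; apply: nbhs_pinfty_ge; exact: num_real.
  near=> t; have t0 : 0 <= t by near: t; apply: nbhs_pinfty_ge; exact: num_real.
  rewrite normr1 mulr1 minE opprK ler_norml.
  by change (- k <= theta t - ratr p * t <= k); have := hp t t0; lra.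
- apply/eqaddOP; near=> k => /=.
  have k0 : theta 0 <= k by near: k; apply: nbhs_pinfty_ge; exact: num_real.
  near=> t; have t0 : t <= 0 by near: t; apply: nbhs_ninfty_le; exact: num_real.
  rewrite normr1 mulr1 maxE ler_norml.
  change (- k <= theta t - - ratr q * t <= k).
  by have := hq (- t) ltac:(by rewrite oppr_ge0); rewrite opprK; lra.
Unshelve. all: by end_near.
Qed.
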